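(* Let $f:\mathbb{X}\to\mathbb{R}$ be a (finite) measurable function. If $\limsup_n B_nf<+\infty$ $\mu$-a.e. on a set of positive measure, then there is a constant $c\in\mathbb{R}\cup\{-\infty\}$ such that $$\lim_n A_n^+f=\lim_n A_n^-f=\lim_n B_nf=c\quad \mu\text{-a.e. on } \mathbb{X}.$$
   Context: Standing assumptions: $(\mathbb{X},\mathcal{X},\mu,T)$ is a probability space with $T$ an invertible, bi-measurable, measure-preserving, ergodic transformation. For measurable $f:\mathbb{X}\to\mathbb{R}$ and $n\ge1$: forward averages $A_n^+f=\frac1n\sum_{i=0}^{n-1}f\circ T^i$, backward averages $A_n^-f=\frac1n\sum_{i=0}^{n-1}f\circ T^{-i}$, and symmetric bilateral averages $B_nf=\frac{1}{2n+1}\sum_{i=-n}^{n}f\circ T^i$. *)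

(* Defs.v *)
From HB Require Import structures.
From mathcomp Require Import all_boot all_order all_algebra.
From mathcomp Require Import all_classical all_reals all_analysis.
Set Implicit Arguments. Unset Strict Implicit. Unset Printing Implicit Defensive.
Import Order.TTheory GRing.Theory Num.Theory.
Local Open Scope ring_scope.

(* Ergodic averages.  For a map [S : X -> X] (later: T or T^{-1}),
   [erg_avg S f n x] is the average of f over the first n+1 iterates,
   i.e. it is  A_{n+1}^+ f (x)  when S = T and  A_{n+1}^- f (x)  when S = T^{-1}.
   (Shifting the index by one avoids the meaningless n = 0 term; limits are
   unaffected.) *)
Definition erg_avg (X : Type) (R : realType) (S : X -> X) (f : X -> R)
    (n : nat) (x : X) : R :=
  (n.+1%:R)^-1 * \sum_(i < n.+1) f (iter i S x).

Definition bil_avg (X : Type) (R : realType) (S Sinv : X -> X) (f : X -> R)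
    (n : nat) (x : X) : R :=
  ((n.*2).+1%:R)^-1 *
    (f x + \sum_(1 <= i < n.+1) f (iter i S x)
         + \sum_(1 <= i < n.+1) f (iter i Sinv x)).

(* Main.v *)
Require Import Defs.
From HB Require Import structures.
From mathcomp Require Import all_boot all_order all_algebra.
From mathcomp Require Import all_classical all_reals all_analysis.
From mathcomp Require Import measurable_realfun lra zify.
Set Implicit Arguments. Unset Strict Implicit. Unset Printing Implicit Defensive.
Import Order.TTheory GRing.Theory Num.Theory.
Local Open Scope classical_set_scope.
Local Open Scope ring_scope.

(** Subtracting a constant, we may assume that all sums of [f] over orbit
    intervals centred at a point of some set [E] of positive measure are
    nonpositive.  Two successive reflections of the orbit in visits to [E]
    compare [S_N f] with one of finitely many initial sums, so that the one-sided
    sums are bounded above, forward and backward.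

    If the forward sums are bounded above, their supremum [M] gives
    [f = M - M o T - h] with [M, h >= 0]; similarly
    [f = M' - M' o T^-1 - h'] with [M', h' >= 0].  Hence
    [- M' o T^-1 - S_n h' <= S_n f <= M - S_n h], and likewise backward.
    By Birkhoff's theorem for nonnegative functions, [h] and [h'] have the same
    integral (possibly infinite) and all averages of [f] tend to its opposite. *)

(** * Birkhoff sums and the set where they are bounded above *)

Definition birkhoff_sum (X : Type) (R : realType) (S : X -> X) (f : X -> R)
    (n : nat) (x : X) : R :=
  \sum_(i < n) f (iter i S x).

Section birkhoff_sum_algebra.
Variables (X : Type) (R : realType) (S : X -> X).
Implicit Types (f g : X -> R) (n m : nat) (x : X).

Lemma birkhoff_sum0 f x : birkhoff_sum S f 0 x = 0.
Proof. exact: big_ord0. Qed.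

Lemma birkhoff_sumS f n x :
  birkhoff_sum S f n.+1 x = f x + birkhoff_sum S f n (S x).
Proof.
rewrite /birkhoff_sum big_ord_recl /=; congr (_ + _).
by apply: eq_bigr => i _; rewrite -iterSr.
Qed.

Lemma birkhoff_sumSr f n x :
  birkhoff_sum S f n.+1 x = birkhoff_sum S f n x + f (iter n S x).
Proof. by rewrite /birkhoff_sum big_ord_recr. Qed.

Lemma birkhoff_sumD f g n x :
  birkhoff_sum S (fun y => f y + g y) n x =
  birkhoff_sum S f n x + birkhoff_sum S g n x.
Proof. exact: big_split. Qed.

Lemma birkhoff_sumB f g n x :
  birkhoff_sum S (fun y => f y - g y) n x =
  birkhoff_sum S f n x - birkhoff_sum S g n x.
Proof. exact: sumrB. Qed.

Lemma birkhoff_sum_cst (r : R) n x : birkhoff_sum S (fun=> r) n x = r * n%:R.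
Proof. by rewrite /birkhoff_sum sumr_const card_ord mulr_natr. Qed.

Lemma birkhoff_sum_le f g n x :
  (forall y, f y <= g y) -> birkhoff_sum S f n x <= birkhoff_sum S g n x.
Proof. by move=> fg; apply: ler_sum. Qed.

Lemma ex_natr_ge (r : R) : exists k : nat, r <= k%:R.
Proof.
exists (Num.bound `|r|); apply: ltW; apply: le_lt_trans (ler_norm r) _.
by apply: archi_boundP.
Qed.

(** Natural numbers as bounds make this a countable union of countable intersections, so
    measurability is immediate. *)
Definition bounded_sums f : set X :=
  \bigcup_(k : nat) \bigcap_(n : nat) [set x | birkhoff_sum S f n x <= k%:R].

Lemma bounded_sumsP f x :
  bounded_sums f x <-> exists K, forall n, birkhoff_sum S f n x <= K.
Proof.
split=> [[k _ bk]|[K bK]]; first by exists k%:R => n; exact: bk.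
have [k Kk] := ex_natr_ge K.
by exists k => // n _; exact: le_trans Kk.
Qed.

Lemma bounded_sums_invariant f : S @^-1` bounded_sums f = bounded_sums f.
Proof.
apply/seteqP; split => x /= /bounded_sumsP[K bK]; apply/bounded_sumsP.
  (* The maximum with [0] covers the empty sum. *)
  exists (Num.max 0 (f x + K)) => -[|n]; rewrite ?birkhoff_sum0 ?le_max ?lexx//.
  by rewrite birkhoff_sumS lerD2l bK orbT.
by exists (K - f x) => n; have := bK n.+1; rewrite birkhoff_sumS; lra.
Qed.

End birkhoff_sum_algebra.

(** * Ergodic maps and boundedness of sums with negative mean *)

Section birkhoff_theorem.
Context d (X : measurableType d) (R : realType) (mu : probability X R).

Record ergodic_map (T : X -> X) : Prop := ErgodicMap {
  ergodic_map_measurable : measurable_fun setT T ;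
  ergodic_map_preserving :
    forall A : set X, measurable A -> mu (T @^-1` A) = mu A ;
  ergodic_map_ergodic : forall A : set X, measurable A -> T @^-1` A = A ->
    mu A = 0%E \/ mu A = 1%E }.

Variables (T : X -> X) (eT : ergodic_map T).
Let mT : measurable_fun setT T := ergodic_map_measurable eT.

Lemma measurable_iter n : measurable_fun setT (iter n T).
Proof.
elim: n => [|n IH]; first exact: measurable_id.
exact: (measurableT_comp mT IH).
Qed.

Lemma measurable_birkhoff_sum (f : X -> R) n :
  measurable_fun setT f -> measurable_fun setT (birkhoff_sum T f n).
Proof.
move=> mf; rewrite /birkhoff_sum; apply: measurable_sum => i.
exact: (measurableT_comp mf (measurable_iter i)).
Qed.

Lemma integral_ergodic_map (g : X -> \bar R) : mu.-integrable setT g ->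
  (mu.-integrable setT (g \o T) /\
   \int[mu]_x g (T x) = \int[mu]_x g x)%E.
Proof.
move=> ig.
have igT : mu.-integrable setT (g \o T).
  have /integrableP[mg intg] := ig.
  apply/integrableP; split; first exact: (measurableT_comp mg mT).
  have /= <- := @ge0_integral_pushforward _ _ X X R T mT mu setT
    (fun x => `|g x|%E) measurableT (measurableT_comp (@abse_measurable _ _) mg)
    (fun y _ => abse_ge0 _).
  rewrite (eq_measure_integral mu)// => A mA _.
  exact: (ergodic_map_preserving eT).
split=> //.
have /integrableP[mg _] := ig.
have /= <- := integral_pushforward mT mg igT measurableT.
by apply: eq_measure_integral => A mA _; exact: (ergodic_map_preserving eT).
Qed.

Lemma ae_exists (P : X -> Prop) : {ae mu, forall x, P x} -> exists x, P x.
Proof.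
move=> [A [mA A0 sub]]; apply: contrapT => /forallNP noP.
have AT : A = setT by apply/seteqP; split => // x _; apply: sub; apply: noP.
by move: A0; rewrite AT probability_setT => /eqP; rewrite onee_eq0.
Qed.

Lemma measurable_bounded_sums (f : X -> R) :
  measurable_fun setT f -> measurable (bounded_sums T f).
Proof.
move=> mf; apply: bigcupT_measurable => k; apply: bigcapT_measurable => n.
have := measurable_birkhoff_sum n mf => /(_ measurableT _
  (measurable_itv `]-oo, k%:R])).
by rewrite setTI; congr measurable; apply/seteqP; split => x /=; rewrite in_itv.
Qed.

(* If the sums were unbounded then, with [M_n = max (0, S_1 g, ..., S_n g)],
   the function [M_n.+1 - M_n o T = max (g, - M_n o T)] would have a nonnegative
   integral, by invariance, and would converge to [g]. *)
Lemma birkhoff_sum_bounded (g : X -> R) : mu.-integrable setT (EFin \o g) ->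
  (\int[mu]_x (g x)%:E < 0)%E ->
  {ae mu, forall x, exists K : R, forall n, birkhoff_sum T g n x <= K}.
Proof.
move=> ig g0.
have mg : measurable_fun setT g by apply/measurable_EFinP; case/integrableP: ig.
pose A := ~` bounded_sums T g.
have mA : measurable A by apply: measurableC; exact: measurable_bounded_sums.
have invA : T @^-1` A = A by rewrite -preimage_setC bounded_sums_invariant.
have [A0|A1] := ergodic_map_ergodic eT mA invA.
  exists A; split => // x /= nb Gx; apply: nb; exact/bounded_sumsP.
exfalso.
have muAC : mu (~` A) = 0%E by rewrite probability_setC// A1 subee.
pose M := fix M n := if n is m.+1
  then (fun x => Num.max 0 (g x + M m (T x))) else (fun=> 0 : R).
have M0 n x : 0 <= M n x by case: n => //= n; rewrite le_max lexx.
have iM n : mu.-integrable setT (EFin \o M n).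
  elim: n => [|n IH] /=; first exact: integrable0.
  have [iMT _] := integral_ergodic_map IH.
  have iD := integrableD measurableT ig iMT.
  apply: (le_integrable measurableT _ _ iD) => /=.
    apply/measurable_EFinP; apply: measurable_maxr => //.
    by have /integrableP[/measurable_EFinP] := iD.
  move=> x _; rewrite lee_fin ger0_norm ?le_max ?lexx//.
  by rewrite ge_max normr_ge0 ler_norm.
have Mmono n x : M n x <= M n.+1 x.
  elim: n x => [x|n IH x]; first exact: M0.
  rewrite [leRHS]/= [leLHS]/= ge_max !le_max lexx /=.
  by apply/orP; right; rewrite lerD2l; exact: IH.
have Mle (m n : nat) x : (m <= n)%N -> M m x <= M n x.
  move=> /subnK <-; elim: (n - m)%N => [|k IH]; first by rewrite add0n.
  by rewrite addSn; apply: le_trans IH (Mmono _ _).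
have Mbs n x : birkhoff_sum T g n x <= M n x.
  elim: n x => [x|n IH x]; first by rewrite birkhoff_sum0.
  by rewrite birkhoff_sumS /= le_max lerD2l IH orbT.
pose u n x := M n.+1 x - M n (T x).
have uE n x : u n x = Num.max (- M n (T x)) (g x).
  rewrite /u /=; case: (leP 0 (g x + M n (T x))) => h;
  case: (leP (- M n (T x)) (g x)) => h'; lra.
have iu n : mu.-integrable setT (EFin \o u n) /\
    (0 <= \int[mu]_x (u n x)%:E)%E.
  have [iMT eMT] := integral_ergodic_map (iM n).
  split; first exact: (integrableB measurableT (iM n.+1) iMT).
  rewrite [leRHS](_ : _ =
    \int[mu]_x ((M n.+1 x)%:E - (M n (T x))%:E))%E//.
  rewrite integralB_EFin// eMT sube_ge0; last first.
    by apply/orP; right; exact: (integrable_fin_num measurableT (iM n.+1)).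
  apply: ge0_le_integral => //.
  - by move=> x _; rewrite lee_fin.
  - by case/integrableP: (iM n).
  - by case/integrableP: (iM n.+1).
  - by move=> x _; rewrite lee_fin; exact: Mmono.
(* By [uE], [u n x] lies between [g x] and [max (0, g x)], so [|g|] dominates. *)
have [|||||_ _ cv] := @dominated_convergence _ _ _ mu setT measurableT
  (fun n => EFin \o u n) (EFin \o g) (EFin \o (fun x => `|g x|)).
- by move=> n; case/integrableP: (iu n).1.
- exact/measurable_EFinP.
- exists (~` A); split; first exact: measurableC.
    exact: muAC.
  move=> x /= + Ax; apply => _.
  (* The sums are unbounded at [T x] too. Once one of them exceeds [- g x], the maximum in [uE]
     equals [g x], and it stays so because [M] is nondecreasing in [n]. *)
  have : (T @^-1` A) x by rewrite invA.
  have [k hk] := ex_natr_ge (- g x).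
  move=> /= /bounded_sumsP/forallNP/(_ k%:R)/existsNP[n /negP].
  rewrite -ltNge => hn.
  apply: cvg_near_cst; exists n => // m /= nm; congr EFin.
  rewrite uE; apply/max_idPr.
  by have := Mle _ _ (T x) nm; have := Mbs n (T x); lra.
- exact: (integrable_abse ig).
- apply: aeW => x n _; rewrite lee_fin uE.
  have := M0 n (T x); have := ler_norm (- g x); rewrite normrN => h1 h2.
  by case: (leP (- M n (T x)) (g x)) => // h; rewrite ler_norml; lra.
have : (0 <= \int[mu]_x (g x)%:E)%E.
  rewrite -(cvg_lim _ cv)//; apply: lime_ge.
    by apply/cvg_ex; eexists; exact: cv.
  by apply: nearW => n; exact: (iu n).2.
by rewrite leNgt g0.
Qed.

End birkhoff_theorem.

(** Serves to absorb bounded errors into a strict gap between slopes. *)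
Lemma near_linear_le (R : realType) (r s K : R) : r < s ->
  \forall n \near \oo, r * n%:R + K <= s * n%:R.
Proof.
move=> rs; have rs0 : 0 < s - r by rewrite subr_gt0.
near=> n; rewrite -subr_ge0 opprD addrA -mulrBl subr_ge0 mulrC.
rewrite -ler_pdivrMr//; near: n; exact: nbhs_infty_ger.
Unshelve. all: by end_near. Qed.

Lemma lte_between (R : realType) (a b : \bar R) : (a < b)%E ->
  exists2 r : R, (a < r%:E)%E & (r%:E < b)%E.
Proof.
case: a b => [a| |] [b| |]//=.
- rewrite lte_fin => ab; exists ((a + b) / 2); rewrite lte_fin; lra.
- by move=> _; exists (a + 1); rewrite ?ltry// lte_fin; lra.
- by move=> _; exists (b - 1); rewrite ?ltNyr// lte_fin; lra.
- by move=> _; exists 0; rewrite ?ltry ?ltNyr.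
Qed.

Lemma integral_cst_probability d (X : measurableType d) (R : realType)
    (mu : probability X R) (r : R) :
  (\int[mu]_x r%:E = r%:E)%E.
Proof.
transitivity (r%:E * mu setT)%E; first exact: integral_cst.
by rewrite probability_setT mule1.
Qed.

(** * Asymptotic bounds for sums of nonnegative functions *)

Section birkhoff_bounds.
Context d (X : measurableType d) (R : realType) (mu : probability X R).
Variables (T : X -> X) (eT : ergodic_map mu T).
Variables (h : X -> R) (mh : measurable_fun setT h) (h0 : forall x, 0 <= h x).

(** For [s] strictly between the integral and [r], the sums of [h - s] are bounded above, and
    [(r - s) n] absorbs the bound. *)
Lemma birkhoff_upper (r : R) : (\int[mu]_x (h x)%:E < r%:E)%E ->
  {ae mu, forall x, \forall n \near \oo, birkhoff_sum T h n x <= r * n%:R}.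
Proof.
move=> hr.
have ih : mu.-integrable setT (EFin \o h).
  apply/integrableP; split; first exact/measurable_EFinP.
  under eq_integral => x _ do rewrite /= ger0_norm//.
  exact: lt_trans hr (ltry _).
have If := integrable_fin_num measurableT ih.
have [s hs sr] : exists2 s : R, (\int[mu]_x (h x)%:E < s%:E)%E & s < r.
  by have [s] := lte_between hr; exists s.
have ic : mu.-integrable setT (EFin \o (fun=> s)).
  exact: finite_measure_integrable_cst.
have := birkhoff_sum_bounded eT (integrableB measurableT ih ic).
rewrite (_ : (\int[mu]_x _)%E = (\int[mu]_x (h x)%:E - s%:E)%E); last first.
  under eq_integral => x _ do rewrite EFinB.
  rewrite integralB_EFin//; congr (_ - _)%E.
  exact: integral_cst_probability.
rewrite sube_lt0 ?orbT// => /(_ hs); apply: filterS => x [K bK].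
have := near_linear_le K sr; apply: filterS => n; apply: le_trans.
have := bK n; rewrite birkhoff_sumB birkhoff_sum_cst; lra.
Qed.

(** The integral may be infinite, so [h] is truncated at a level [k] for which the integral still
    exceeds [r], by monotone convergence. For [s] between [r] and that integral, the sums of
    [s - hk k] are bounded above. *)
Lemma birkhoff_lower (r : R) : (r%:E < \int[mu]_x (h x)%:E)%E ->
  {ae mu, forall x, \forall n \near \oo, r * n%:R <= birkhoff_sum T h n x}.
Proof.
move=> hr.
pose hk (k : nat) x := Num.min (h x) k%:R.
have mhk k : measurable_fun setT (hk k) by exact: measurable_minr.
have hk0 k x : 0 <= hk k x by rewrite le_min h0 ler0n.
have ihk k : mu.-integrable setT (EFin \o hk k).
  apply: (@le_integrable _ _ _ mu setT measurableT _ (EFin \o (fun=> k%:R))).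
  - exact/measurable_EFinP.
  - move=> x _; rewrite /= lee_fin ger0_norm// ger0_norm//.
    by rewrite ge_min lexx orbT.
  - exact: finite_measure_integrable_cst.
have [k rk] : exists k, (r%:E < \int[mu]_x (hk k x)%:E)%E.
  apply: contrapT => /forallNP noK.
  suff : (\int[mu]_x (h x)%:E <= r%:E)%E by rewrite leNgt hr.
  have -> : (\int[mu]_x (h x)%:E =
      \int[mu]_x limn (fun k => (hk k x)%:E))%E.
    apply: eq_integral => x _; apply/esym/cvg_lim => //.
    apply: cvg_near_cst; near=> k; congr EFin; apply/min_idPl.
    by near: k; exact: nbhs_infty_ger.
  apply: (@cvge_le _ \oo _ _ (fun k => \int[mu]_x (hk k x)%:E)%E).
    by apply: nearW => k; rewrite leNgt; apply/negP/noK.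
  apply: cvg_monotone_convergence => //.
  - by move=> k; exact/measurable_EFinP.
  - by move=> k x _; rewrite lee_fin.
  - move=> x _ k l kl; rewrite lee_fin /hk le_min !ge_min lexx /=.
    by rewrite ler_nat kl orbT.
have If := integrable_fin_num measurableT (ihk k).
have [s hs sr] : exists2 s : R, (s%:E < \int[mu]_x (hk k x)%:E)%E & r < s.
  by have [s] := lte_between rk; exists s.
have ic : mu.-integrable setT (EFin \o (fun=> s)).
  exact: finite_measure_integrable_cst.
have := birkhoff_sum_bounded eT (integrableB measurableT ic (ihk k)).
rewrite (_ : (\int[mu]_x _)%E = (s%:E - \int[mu]_x (hk k x)%:E)%E); last first.
  under eq_integral => x _ do rewrite EFinB.
  rewrite integralB_EFin//; congr (_ - _)%E.
  exact: integral_cst_probability.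
rewrite sube_lt0 ?orbT// => /(_ hs); apply: filterS => x [K bK].
have := near_linear_le K sr; apply: filterS => n.
have := bK n; rewrite birkhoff_sumB birkhoff_sum_cst => h1 h2.
apply: (@le_trans _ _ (birkhoff_sum T (hk k) n x)); first lra.
by apply: birkhoff_sum_le => y; rewrite ge_min lexx.
Unshelve. all: by end_near. Qed.

End birkhoff_bounds.

(** * Reflection of orbit segments in a visit to [E] *)

Section reflection.
Variables (X : Type) (R : realType) (T Tinv : X -> X) (hTK : cancel T Tinv).
Variable f : X -> R.

Lemma iter_cancel n m x : (n <= m)%N ->
  iter n Tinv (iter m T x) = iter (m - n) T x.
Proof.
elim: n => [|n IH] nm; first by rewrite subn0.
by rewrite iterS IH ?(ltnW nm)// -(subnSK nm) iterS hTK.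
Qed.

(** Backward iterates of [iter p T x] cancel forward ones, so the window is the orbit segment of [x]
    from time [p - n] to time [p + n]. *)
Lemma bil_avg_iter n p x : (n <= p)%N ->
  bil_avg T Tinv f n (iter p T x) = ((n.*2).+1%:R)^-1 *
    (birkhoff_sum T f (p + n).+1 x - birkhoff_sum T f (p - n) x).
Proof.
move=> np; rewrite /bil_avg; congr (_ * _).
elim: n np => [|n IH] np.
  rewrite !big_geq// subn0 addn0 birkhoff_sumSr; lra.
have recr S y : \sum_(1 <= i < n.+2) f (iter i S y) =
    \sum_(1 <= i < n.+1) f (iter i S y) + f (iter n.+1 S y).
  by rewrite big_nat_recr.
rewrite !recr (iter_cancel x np) -iterD (addnC n.+1) addnS.
rewrite (birkhoff_sumSr T f (p + n).+1); have := IH (ltnW np).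
rewrite -(subnSK np) (birkhoff_sumSr T f (p - n.+1)); lra.
Qed.

(** The window of radius [p - a] about [p] covers the times [a] to [2 p - a], and its sum is
    nonpositive because its centre lies in [E]. *)
Lemma birkhoff_sum_reflect (E : set X) p a x :
  (forall y, E y -> forall n, bil_avg T Tinv f n y <= 0) ->
  E (iter p T x) -> (a <= p)%N ->
  birkhoff_sum T f (p.*2.+1 - a) x <= birkhoff_sum T f a x.
Proof.
move=> Ef Ep ap; have := Ef _ Ep (p - a)%N.
rewrite bil_avg_iter ?leq_subr// pmulr_rle0 ?invr_gt0 ?ltr0n// subr_le0.
by rewrite subKn// (_ : (p + (p - a)).+1 = p.*2.+1 - a)%N//; lia.
Qed.

End reflection.

(** * From nonpositive bilateral averages to bounded one-sided sums *)

Section visits.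
Context d (X : measurableType d) (R : realType) (mu : probability X R).
Variables (T Tinv : X -> X) (eT : ergodic_map mu T) (hTK : cancel T Tinv).
Variable f : X -> R.
Variables (E : set X) (mE : measurable E) (E0 : (0 < mu E)%E).

Lemma integral_indicT (A : set X) : measurable A ->
  (\int[mu]_x (\1_A x)%:E = mu A)%E.
Proof. by move=> mA; rewrite integral_indic// setIT. Qed.

Definition hits_within (L : nat) : set X :=
  \bigcup_(j in [set j | (j <= L)%N]) (iter j T @^-1` E).

Lemma measurable_misses L : measurable (~` hits_within L).
Proof.
apply: measurableC; apply: bigcup_measurable => j _.
by rewrite -[X in measurable X]setTI; exact: (measurable_iter eT).
Qed.

(** A positive frequency of visits forces almost every point to visit [E]. The sets of points
    missing [E] up to time [L] thus decrease to a null set, and continuity from above applies. *)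
Lemma hits_within_large (e : R) : 0 < e ->
  exists L, (mu (~` hits_within L) < e%:E)%E.
Proof.
move=> e0.
have [r r0 rE] := lte_between E0.
have := birkhoff_lower eT (measurable_indic mE)
  (fun x => ler0n R _) (r := r).
rewrite integral_indicT// => /(_ rE) lowE.
pose U := \bigcap_L ~` hits_within L.
have mU : measurable U.
  by apply: bigcapT_measurable => L; exact: measurable_misses.
have U0 : mu U = 0%E.
  apply: measure_negligible => //; case: lowE => A [mA A0 sub].
  (* Without visits all sums vanish, against a positive linear lower bound; time [n.+1] keeps that
     bound positive. *)
  exists A; split => // x Ux; apply: sub => /= -[n _ /(_ n.+1 (leqnSn n))].
  rewrite /birkhoff_sum big1 ?leNgt ?mulr_gt0 ?ltr0n//.
  move=> i _; rewrite indicE memNset// => Ei; apply: (Ux i I).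
  by exists i => /=.
have := @nonincreasing_cvg_mu _ X R mu (fun L => ~` hits_within L).
move=> /(_ _ _ _ _) cv; apply: contrapT => /forallNP noL.
suff : (e%:E <= mu U)%E by rewrite U0 lee_fin leNgt e0.
apply: (@cvge_ge _ \oo _ _ (fun L => mu (~` hits_within L))).
  by apply: nearW => L; rewrite leNgt; apply/negP/noL.
apply: cv.
- apply: le_lt_trans (ltry 1); apply: probability_le1.
  exact: measurable_misses.
- by move=> L; exact: measurable_misses.
- exact: mU.
- move=> L L' LL'; apply/subsetPset => x /=; apply: contra_not => -[j /= jL Ej].
  by exists j => //=; exact: leq_trans LL'.
Qed.

Hypothesis Ef : forall y, E y -> forall n, bil_avg T Tinv f n y <= 0.

(* Reflecting a starting point [a] in the visit [p] and the result in the visit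
   [q = p + H + j] translates [a] by [2 (H + j)], and the sums do not increase.
   The start [a <= 2 L + 1] is free, which leaves enough room to find [q]. *)
Lemma birkhoff_sum_bounded_of_bil_avg :
  {ae mu, forall x, exists K, forall n, birkhoff_sum T f n x <= K}.
Proof.
(* Visits to [E] will have frequency at least [3 e], and misses up to time [L] frequency at most
   [e]. Even over a time span twice as long, the misses are outnumbered. *)
have [e e0 eE] : exists2 e : R, 0 < e & ((3 * e)%:E < mu E)%E.
  have [r r0 rE] := lte_between E0.
  by exists (r / 3); [move: r0; rewrite lte_fin; lra|rewrite mulrC divfK].
have [L hL] := hits_within_large e0.
have mF : measurable (~` hits_within L).
  exact: measurable_misses.
have := birkhoff_lower eT (measurable_indic mE)
  (fun x => ler0n R _) (r := 3 * e).
have := birkhoff_upper eT (measurable_indic mF)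
  (fun x => ler0n R _) (r := e).
rewrite !integral_indicT// => /(_ hL) + /(_ eE).
apply: filterS2 => x [n1 _ h1] [n2 _ h2].
have e23 : 2 * e < 3 * e by lra.
(* One more than the [2 L + 1] times discarded below, to make the final inequality strict. *)
have [n3 _ h3] := near_linear_le (L.*2.+2)%:R e23.
have [k hk] : exists k, forall N, (k <= N)%N -> exists2 a, (a <= L.*2.+1)%N &
    birkhoff_sum T f N x <= birkhoff_sum T f a x.
  exists ((n1 + n2 + n3 + L).+1).*2 => N kN.
  (* With this choice [N - 2 (H + j)] is [odd N + 2 (L - j)], which lies between [0] and [2 L + 1]
     for every [j <= L]. *)
  pose H := (N./2 - L)%N.
  have [p [pL pH Ep Fp]] : exists p, [/\ (L.*2.+1 <= p)%N, (p < H)%N,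
      E (iter p T x) & hits_within L (iter (p + H) T x)].
    apply: contrapT => /forallNP nop.
    have := h3 H; have := h2 H; have := h1 (H + H)%N; rewrite /=.
    move=> /(_ ltac:(lia)) a1 /(_ ltac:(lia)) a2 /(_ ltac:(lia)) a3.
    suff : birkhoff_sum T (\1_E : X -> R) H x <=
        (L.*2.+1)%:R +
        birkhoff_sum T (\1_(~` hits_within L) : X -> R) (H + H)%N x.
      by move: a1 a2 a3; rewrite natrD -[in (L.*2.+2)%:R]natr1; lra.
    have sum_lt n m : (\sum_(i < n) (i < m) <= m)%N.
      have -> : (\sum_(i < n) (i < m) = minn n m)%N.
        elim: n => [|n IH]; first by rewrite big_ord0 min0n.
        by rewrite big_ord_recr /= IH; lia.
      exact: geq_minr.
    apply: (@le_trans _ _ ((\sum_(i < H) (i < L.*2.+1))%:R +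
        \sum_(i < H) (\1_(~` hits_within L) (iter (H + i) T x) : R))); last first.
      rewrite lerD ?ler_nat ?sum_lt// /birkhoff_sum big_split_ord /= lerDr.
      exact: sumr_ge0.
    rewrite natr_sum -big_split /=; apply: ler_sum => i _.
    rewrite !indicE; have [iL|Li] := ltnP i L.*2.+1.
      by rewrite (@le_trans _ _ 1) ?lerDl// lern1 leq_b1.
    have [/set_mem Ei|_] := boolP (iter i T x \in E); last by rewrite addr_ge0.
    rewrite mem_set ?add0r//= => hit; apply: (nop i); split => //.
    by rewrite addnC.
  case: Fp => j /= jL Eq.
  (* The first reflection, allowed by [a <= 2 L + 1 <= p], sends [a] to [2 p + 1 - a]. The second,
     allowed by [p < H], sends this to [2 q + 1 - (2 p + 1 - a) = N]. *)
  exists (odd N + (L - j).*2)%N; first lia.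
  have := birkhoff_sum_reflect hTK Ef Ep (a := odd N + (L - j).*2) ltac:(lia).
  apply: le_trans.
  rewrite -iterD in Eq.
  have := birkhoff_sum_reflect hTK Ef Eq
    (a := p.*2.+1 - (odd N + (L - j).*2)) ltac:(lia).
  by congr (birkhoff_sum _ _ _ _ <= _); lia.
(* One bound for the sums before time [k] and for all possible starts [a]. *)
exists (\sum_(i < maxn k L.*2.+2) `|birkhoff_sum T f i x|) => n.
have small m : (m < maxn k L.*2.+2)%N -> birkhoff_sum T f m x <=
    \sum_(i < maxn k L.*2.+2) `|birkhoff_sum T f i x|.
  move=> mm; rewrite (bigD1 (Ordinal mm))//=.
  by rewrite (le_trans (ler_norm _))// lerDl sumr_ge0.
case: (ltnP n k) => nk; first by apply: small; rewrite leq_max nk.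
have [a aL] := hk _ nk; move=> /le_trans; apply; apply: small.
by rewrite leq_max ltnS aL orbT.
Qed.

End visits.

(** * Growth rates and convergence of the averages *)

Section birkhoff_rate.
Context (X : Type) (R : realType).
Implicit Types (S : X -> X) (f : X -> R) (c : \bar R).

(* [S_n f (x) / n] tends to [c], in a form that treats infinite [c] uniformly. *)
Definition birkhoff_rate S f c x :=
  (forall r : R, (c < r%:E)%E ->
    \forall n \near \oo, birkhoff_sum S f n x <= r * n%:R) /\
  (forall r : R, (r%:E < c)%E ->
    \forall n \near \oo, r * n%:R <= birkhoff_sum S f n x).

Lemma birkhoff_rateD S f c (K : R) x :
  birkhoff_rate S f c x -> birkhoff_rate S (fun y => f y + K) (c + K%:E)%E x.
Proof.
move=> [up lo]; split=> r cr.
  have /up : (c < (r - K)%:E)%E by rewrite EFinB lteBrDr.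
  apply: filterS => n; rewrite birkhoff_sumD birkhoff_sum_cst; lra.
have /lo : ((r - K)%:E < c)%E by rewrite EFinB lteBlDr.
apply: filterS => n; rewrite birkhoff_sumD birkhoff_sum_cst; lra.
Qed.

Lemma cvg_EFin_order (u : R^nat) c : c != +oo%E ->
  (forall r : R, (c < r%:E)%E -> \forall n \near \oo, u n <= r) ->
  (forall r : R, (r%:E < c)%E -> \forall n \near \oo, r <= u n) ->
  (fun n => (u n)%:E) @ \oo --> c.
Proof.
case: c => [c _ up lo|//|_ up _]; last first.
  apply/cvgeNyPle => A.
  by have := up A (ltNyr _); apply: filterS => n; rewrite lee_fin.
apply: cvg_EFin; first exact: nearW.
apply/cvgrPdist_le => e e0.
have /up : (c%:E < (c + e)%:E)%E by rewrite lte_fin; lra.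
have /lo : ((c - e)%:E < c%:E)%E by rewrite lte_fin; lra.
by apply: filterS2 => n /= h1 h2; rewrite ler_distlC; lra.
Qed.

(** Accounts for the index shift in [erg_avg], which averages [n.+1] terms at index [n]. *)
Lemma near_succ (P : nat -> Prop) :
  (\forall n \near \oo, P n) -> \forall n \near \oo, P n.+1.
Proof. by move=> [N _ NP]; exists N => // n /= Nn; apply: NP; exact: leqW. Qed.

Lemma cvg_erg_avg S f c x : c != +oo%E -> birkhoff_rate S f c x ->
  (fun n => (erg_avg S f n x)%:E) @ \oo --> c.
Proof.
move=> cy [up lo]; apply: cvg_EFin_order => // r cr.
  have := near_succ (up r cr); apply: filterS => n.
  by rewrite /erg_avg ler_pdivrMl ?ltr0n// [n.+1%:R * r]mulrC.
have := near_succ (lo r cr); apply: filterS => n.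
by rewrite /erg_avg ler_pdivlMl ?ltr0n// [n.+1%:R * r]mulrC.
Qed.

(** The starting point is counted in both one-sided sums. *)
Lemma bil_avgE S Sinv f n x : bil_avg S Sinv f n x = ((n.*2).+1%:R)^-1 *
  (birkhoff_sum S f n.+1 x + birkhoff_sum Sinv f n.+1 x - f x).
Proof.
have sumE U : birkhoff_sum U f n.+1 x =
    f x + \sum_(1 <= i < n.+1) f (iter i U x).
  by rewrite /birkhoff_sum -(big_mkord predT (fun i => f (iter i U x))) big_ltn.
rewrite /bil_avg !sumE; congr (_ * _); lra.
Qed.

Lemma bil_avgC S Sinv f n x : bil_avg Sinv S f n x = bil_avg S Sinv f n x.
Proof. by rewrite !bil_avgE [X in X - _]addrC. Qed.

Lemma bil_avgB S Sinv f (K : R) n x :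
  bil_avg S Sinv (fun y => f y - K) n x = bil_avg S Sinv f n x - K.
Proof.
rewrite !bil_avgE !birkhoff_sumB !birkhoff_sum_cst.
have n0 : (n.*2.+1%:R : R) != 0 by rewrite pnatr_eq0.
apply: (mulfI n0); rewrite mulVKf// [RHS]mulrBr mulVKf//.
rewrite -[in n.*2.+1%:R]natr1 -addnn natrD -natr1; lra.
Qed.

Lemma cvg_bil_avg S Sinv f c x : c != +oo%E ->
  birkhoff_rate S f c x -> birkhoff_rate Sinv f c x ->
  (fun n => (bil_avg S Sinv f n x)%:E) @ \oo --> c.
Proof.
move=> cy [up lo] [up' lo']; apply: cvg_EFin_order => // r.
(* The gap between [s] and [r] absorbs [f x] and the mismatch between [2 (n + 1)] summands and the
   denominator [2 n + 1]. *)
- move=> /lte_between[s cs]; rewrite lte_fin => sr.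
  have sr2 : 2 * s < 2 * r by lra.
  near=> n.
  have a1 : birkhoff_sum S f n.+1 x <= s * n.+1%:R.
    by near: n; exact: near_succ (up s cs).
  have a2 : birkhoff_sum Sinv f n.+1 x <= s * n.+1%:R.
    by near: n; exact: near_succ (up' s cs).
  have a3 : 2 * s * n%:R + (2 * s - f x - r) <= 2 * r * n%:R.
    by near: n; exact: near_linear_le.
  rewrite bil_avgE ler_pdivrMl ?ltr0n// -natr1 -addnn natrD.
  by move: a1 a2; rewrite -natr1; lra.
- move=> /lte_between[s]; rewrite lte_fin => rs sc.
  have rs2 : 2 * r < 2 * s by lra.
  near=> n.
  have a1 : s * n.+1%:R <= birkhoff_sum S f n.+1 x.
    by near: n; exact: near_succ (lo s sc).
  have a2 : s * n.+1%:R <= birkhoff_sum Sinv f n.+1 x.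
    by near: n; exact: near_succ (lo' s sc).
  have a3 : 2 * r * n%:R + (r + f x - 2 * s) <= 2 * s * n%:R.
    by near: n; exact: near_linear_le.
  rewrite bil_avgE ler_pdivlMl ?ltr0n// -natr1 -addnn natrD.
  by move: a1 a2; rewrite -natr1; lra.
Unshelve. all: by end_near. Qed.

End birkhoff_rate.

(** * Almost everywhere rates and coboundary decompositions *)

Section coboundary.
Context d (X : measurableType d) (R : realType) (mu : probability X R).

(** The exceptional null set must not depend on [r]. Rational slopes, enumerated by [unpickle],
    suffice: one fits strictly between [c] and [r], and [r * n] is monotone in [r]. *)
Lemma ae_birkhoff_rate (S : X -> X) (f : X -> R) (c : \bar R) :
  (forall r : R, (c < r%:E)%E -> {ae mu, forall x,
    \forall n \near \oo, birkhoff_sum S f n x <= r * n%:R}) ->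
  (forall r : R, (r%:E < c)%E -> {ae mu, forall x,
    \forall n \near \oo, r * n%:R <= birkhoff_sum S f n x}) ->
  {ae mu, forall x, birkhoff_rate S f c x}.
Proof.
move=> up lo.
have up' : {ae mu, forall x, forall q : nat,
    forall s, unpickle q = Some s -> (c < (ratr s)%:E)%E ->
    \forall n \near \oo, birkhoff_sum S f n x <= ratr s * n%:R}.
  apply: ae_foralln => q; case: (unpickle q) => [s|]; last exact: aeW.
  have [/up|cs] := boolP (c < (ratr s)%:E)%E; last first.
    by apply: aeW => x _ [<-]; rewrite (negbTE cs).
  by apply: filterS => x h _ [<-].
have lo' : {ae mu, forall x, forall q : nat,
    forall s, unpickle q = Some s -> ((ratr s)%:E < c)%E ->
    \forall n \near \oo, ratr s * n%:R <= birkhoff_sum S f n x}.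
  apply: ae_foralln => q; case: (unpickle q) => [s|]; last exact: aeW.
  have [/lo|cs] := boolP ((ratr s)%:E < c)%E; last first.
    by apply: aeW => x _ [<-]; rewrite (negbTE cs).
  by apply: filterS => x h _ [<-].
move: up' lo'; apply: filterS2 => x up' lo'; split=> r /lte_between[s].
- rewrite lte_fin => cs /rat_in_itvoo[q]; rewrite in_itv /= => /andP[sq qr].
  have := up' (pickle q) q (pickleK _) (lt_trans cs _).
  rewrite lte_fin => /(_ sq); apply: filterS => n /le_trans; apply.
  by rewrite ler_wpM2r// ltW.
- rewrite lte_fin => /rat_in_itvoo[q]; rewrite in_itv /= => /andP[rq qs] sc.
  have := lo' (pickle q) q (pickleK _) (lt_trans _ sc).
  rewrite lte_fin => /(_ qs); apply: filterS => n; apply: le_trans.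
  by rewrite ler_wpM2r// ltW.
Qed.

(** Taking suprema in the recursion for the sums gives [f + M o S <= M], and [h] is the deficit.
    Boundedness at every point keeps [M] real-valued. *)
Lemma coboundary_decomposition (S : X -> X) (f : X -> R) :
  ergodic_map mu S -> measurable_fun setT f ->
  (forall x, bounded_sums S f x) ->
  exists M h : X -> R, [/\ measurable_fun setT M, measurable_fun setT h,
    forall x, 0 <= M x, forall x, 0 <= h x &
    forall x, f x = M x - M (S x) - h x].
Proof.
move=> eS mf bf.
(* The supremum starts at the empty sum, whence [M >= 0]. *)
pose M x := sups (fun n => birkhoff_sum S f n x) 0.
have ub x : has_ubound (range (fun n => birkhoff_sum S f n x)).
  by have /bounded_sumsP[K bK] := bf x; exists K => _ [n _ <-].
have leM n x : birkhoff_sum S f n x <= M x.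
  apply: ub_le_sup; last by exists n.
  by have [K bK] := ub x; exists K => _ [m _ <-]; apply: bK; exists m.
have Mle x K : (forall n, birkhoff_sum S f n x <= K) -> M x <= K.
  move=> bK; apply: ge_sup; first by exists (birkhoff_sum S f 0 x); exists 0%N.
  by move=> _ [m _ <-].
have mM : measurable_fun setT M.
  apply: measurable_fun_sups => [x _|n]; first exact: ub.
  exact: measurable_birkhoff_sum eS _ _ mf.
exists M, (fun x => M x - M (S x) - f x); split => //.
- apply: measurable_funB => //; apply: measurable_funB => //.
  exact: (measurableT_comp mM (ergodic_map_measurable eS)).
- by move=> x; have := leM 0%N x; rewrite birkhoff_sum0.
- move=> x; have : M (S x) <= M x - f x.
    by apply: Mle => n; have := leM n.+1 x; rewrite birkhoff_sumS; lra.
  lra.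
- by move=> x; lra.
Qed.

Lemma birkhoff_sum_coboundary (S : X -> X) (f M h : X -> R) n x :
  (forall y, f y = M y - M (S y) - h y) ->
  birkhoff_sum S f n x = M x - M (iter n S x) - birkhoff_sum S h n x.
Proof.
move=> fE; elim: n => [|n IH]; first by rewrite !birkhoff_sum0 /=; lra.
by rewrite !birkhoff_sumSr IH fE /=; lra.
Qed.

End coboundary.

(** * Comparison of the forward and backward decompositions *)

Section two_sided.
Context d (X : measurableType d) (R : realType) (mu : probability X R).

Section one_direction.
Variables (T Tinv : X -> X) (eT : ergodic_map mu T) (hTK : cancel T Tinv).
Variables (f M h M' h' : X -> R).
Hypotheses (mh : measurable_fun setT h) (mh' : measurable_fun setT h').
Hypotheses (M0 : forall x, 0 <= M x) (M0' : forall x, 0 <= M' x).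
Hypotheses (h0 : forall x, 0 <= h x) (h0' : forall x, 0 <= h' x).
Hypothesis fE : forall x, f x = M x - M (T x) - h x.
Hypothesis fE' : forall x, f x = M' x - M' (Tinv x) - h' x.

Lemma coboundary_upper n x :
  birkhoff_sum T f n x <= M x - birkhoff_sum T h n x.
Proof.
by rewrite (birkhoff_sum_coboundary _ _ fE); have := M0 (iter n T x); lra.
Qed.

(** The backward decomposition becomes a forward one with transfer function [- M' o Tinv], which is
    nonpositive. *)
Lemma coboundary_lower n x :
  - M' (Tinv x) - birkhoff_sum T h' n x <= birkhoff_sum T f n x.
Proof.
pose N y := - M' (Tinv y).
have fN y : f y = N y - N (T y) - h' y by rewrite /N hTK fE'; lra.
rewrite (birkhoff_sum_coboundary _ _ fN) /N.
by have := M0' (Tinv (iter n T x)); lra.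
Qed.

(** The upper and lower bounds leave [S_n h - S_n h'] bounded above at each point, whereas a larger
    integral of [h] would make it grow linearly. *)
Lemma coboundary_integral_le :
  (\int[mu]_x (h x)%:E <= \int[mu]_x (h' x)%:E)%E.
Proof.
rewrite leNgt; apply/negP => /lte_between[r h'r /lte_between[s]].
rewrite lte_fin => rs sh.
have up := birkhoff_upper eT mh' h0' h'r.
have lo := birkhoff_lower eT mh h0 sh.
have [|x [ux lx]] := @ae_exists _ _ _ mu (fun x =>
  (\forall n \near \oo, birkhoff_sum T h' n x <= r * n%:R) /\
  (\forall n \near \oo, s * n%:R <= birkhoff_sum T h n x)).
  by move: up lo; apply: filterS2.
have [n [[a b] c]] := @filter_ex _ \oo _ _ (filterI (filterI ux lx)
  (near_linear_le (M x + M' (Tinv x) + 1) rs)).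
by have := coboundary_upper n x; have := coboundary_lower n x; lra.
Qed.

(** Growth of the sums of [h] controls [f] from above, that of the sums of [h'] from below; equal
    integrals make the two rates meet. *)
Lemma coboundary_birkhoff_rate :
  (\int[mu]_x (h x)%:E = \int[mu]_x (h' x)%:E)%E ->
  {ae mu, forall x, birkhoff_rate T f (- \int[mu]_x (h x)%:E)%E x}.
Proof.
move=> hh'; apply: ae_birkhoff_rate => r.
  rewrite lteNl => /lte_between[s]; rewrite lte_fin => rs sh.
  have := birkhoff_lower eT mh h0 sh; apply: filterS => x sx.
  have sr : - s < r by lra.
  have := near_linear_le (M x) sr; move: sx; apply: filterS2 => n.
  by have := coboundary_upper n x; lra.
rewrite lteNr hh' => /lte_between[s hs]; rewrite lte_fin => sr.
have := birkhoff_upper eT mh' h0' hs; apply: filterS => x sx.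
have rs : r < - s by lra.
have := near_linear_le (M' (Tinv x)) rs; move: sx; apply: filterS2 => n.
by have := coboundary_lower n x; lra.
Qed.

End one_direction.

Lemma birkhoff_sum_mul_indic (S : X -> X) (G : set X) (f : X -> R) n x :
  S @^-1` G = G ->
  birkhoff_sum S (fun y => \1_G y * f y) n x = \1_G x * birkhoff_sum S f n x.
Proof.
move=> SG; rewrite /birkhoff_sum mulr_sumr; apply: eq_bigr => i _.
have inv y : \1_G (S y) = \1_G y :> R by rewrite -[in RHS]SG.
by congr (_ * _); elim: (i : nat) => //= j <-; rewrite inv.
Qed.

Variables (T Tinv : X -> X) (eT : ergodic_map mu T).
Hypotheses (hTK : cancel T Tinv) (hKT : cancel Tinv T).
Hypothesis mTinv : measurable_fun setT Tinv.

Lemma preimage_inv (G : set X) : T @^-1` G = G -> Tinv @^-1` G = G.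
Proof.
move=> TG; rewrite -[in LHS]TG -comp_preimage.
by rewrite (_ : T \o Tinv = id)//; apply/funext => x /=; rewrite hKT.
Qed.

Lemma ergodic_map_inv : ergodic_map mu Tinv.
Proof.
have preK (A : set X) : T @^-1` (Tinv @^-1` A) = A.
  by apply/seteqP; split => x /=; rewrite hTK.
split => // A mA.
  rewrite -(ergodic_map_preserving eT) ?preK//.
  by rewrite -[X in measurable X]setTI; exact: mTinv.
by move=> TA; apply: (ergodic_map_ergodic eT mA); rewrite -[in LHS]TA preK.
Qed.

(** The decomposition asks for bounded sums at every point, so [f] is first multiplied by the
    indicator of the invariant set [G] of full measure, on which the sums are unchanged. *)
Lemma two_sided_birkhoff_rate (f : X -> R) : measurable_fun setT f ->
  {ae mu, forall x, bounded_sums T f x} ->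
  {ae mu, forall x, bounded_sums Tinv f x} ->
  exists2 c : \bar R, c != +oo%E &
    {ae mu, forall x, birkhoff_rate T f c x /\ birkhoff_rate Tinv f c x}.
Proof.
move=> mf bT bTinv.
have eTi := ergodic_map_inv.
pose G := bounded_sums T f `&` bounded_sums Tinv f.
have mG : measurable G.
  apply: measurableI; first exact: (measurable_bounded_sums eT mf).
  exact: (measurable_bounded_sums eTi mf).
have TG : T @^-1` G = G.
  rewrite preimage_setI bounded_sums_invariant.
  rewrite -[X in _ `&` T @^-1` X = _]bounded_sums_invariant -comp_preimage.
  by rewrite (_ : Tinv \o T = id)//; apply/funext => x /=; rewrite hTK.
have TiG := preimage_inv TG.
pose g x := \1_G x * f x.
have mg : measurable_fun setT g.
  by apply: measurable_funM => //; exact: measurable_indic.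
have bg S : S @^-1` G = G -> G `<=` bounded_sums S f ->
    forall x, bounded_sums S g x.
  move=> SG GS x; apply/bounded_sumsP.
  have [Gx|nGx] := pselect (G x).
    have /bounded_sumsP[K bK] := GS _ Gx; exists K => n.
    by rewrite birkhoff_sum_mul_indic// indicE mem_set// mul1r.
  by exists 0 => n; rewrite birkhoff_sum_mul_indic// indicE memNset// mul0r.
have [M [h [mM mh M0 h0 gE]]] :=
  coboundary_decomposition eT mg (bg _ TG (@subIsetl _ _ _)).
have [M' [h' [mM' mh' M0' h0' gE']]] :=
  coboundary_decomposition eTi mg (bg _ TiG (@subIsetr _ _ _)).
have hh' : (\int[mu]_x (h x)%:E = \int[mu]_x (h' x)%:E)%E.
  (* The integral comparison is used for [T] and for [Tinv], with the two decompositions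
     exchanged. *)
  apply/eqP; rewrite eq_le.
  by rewrite (coboundary_integral_le eT hTK mh mh' M0 M0' h0 h0' gE gE')
    (coboundary_integral_le eTi hKT mh' mh M0' M0 h0' h0 gE' gE).
exists (- \int[mu]_x (h x)%:E)%E.
  rewrite eqe_oppLR/= -ltNye; apply: lt_le_trans (ltNyr 0) _.
  by apply: integral_ge0 => x _; rewrite lee_fin.
have rT := coboundary_birkhoff_rate eT hTK mh mh' M0 M0' h0 h0' gE gE' hh'.
have := coboundary_birkhoff_rate eTi hKT mh' mh M0' M0 h0' h0 gE' gE (esym hh').
rewrite -hh' => rTi.
have rate_eq S c x : S @^-1` G = G -> G x ->
    birkhoff_rate S g c x -> birkhoff_rate S f c x.
  move=> SG Gx.
  have gf n : birkhoff_sum S g n x = birkhoff_sum S f n x.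
    by rewrite birkhoff_sum_mul_indic// indicE mem_set// mul1r.
  by move=> [u l]; split => r hr; [have := u r hr|have := l r hr];
    apply: filterS => n; rewrite gf.
near=> x.
have Gx : G x by split; near: x.
by split; apply: rate_eq => //; near: x.
Unshelve. all: by end_near. Qed.

End two_sided.

(** * Reduction of the theorem to nonpositive bilateral averages *)

Lemma limn_esup_lty_bounded (R : realType) (u : R^nat) :
  (limn_esup (fun n => (u n)%:E) < +oo)%E ->
  exists k : nat, forall n, u n <= k%:R.
Proof.
move=> /ereal_inf_lt[_ [V [N _ NV] <-]] supV.
(* The limsup bounds only a tail; the finitely many earlier terms enter through their absolute
   values. *)
have [K bK] : exists K : R, forall n, (N <= n)%N -> u n <= K.
  have [K hK _] := lte_between supV; exists K => n Nn.
  rewrite -lee_fin; apply: le_trans (ltW hK).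
  by apply: ereal_sup_ubound; exists n => //; exact: NV.
have [k hk] := ex_natr_ge (`|K| + \sum_(i < N) `|u i|).
exists k => n; apply: le_trans hk; have [nN|Nn] := ltnP n N.
  rewrite (bigD1 (Ordinal nN))//=.
  have := ler_norm (u n); have := normr_ge0 K.
  have : 0 <= \sum_(i < N | i != Ordinal nN) `|u i| by exact: sumr_ge0.
  lra.
have := bK n Nn; have := ler_norm K.
have : 0 <= \sum_(i < N) `|u i| by exact: sumr_ge0.
lra.
Qed.

Theorem theorem1 (d : measure_display) (X : measurableType d) (R : realType)
  (mu : probability X R) (T Tinv : X -> X)
  (hTK : cancel T Tinv) (hKT : cancel Tinv T)
  (mT : measurable_fun setT T) (mTinv : measurable_fun setT Tinv)
  (pres : forall A : set X, measurable A -> mu (T @^-1` A) = mu A)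
  (ergo : forall A : set X, measurable A -> T @^-1` A = A ->
            mu A = 0%E \/ mu A = 1%E)
  (f : X -> R) (mf : measurable_fun setT f) :
  (exists E : set X, measurable E /\ (0 < mu E)%E /\
     {ae mu, forall x, E x ->
        (limn_esup (fun n => (bil_avg T Tinv f n x)%:E) < +oo)%E}) ->
  exists c : \bar R, c != +oo%E /\
    {ae mu, forall x,
       (fun n => (erg_avg T f n x)%:E) @ \oo --> c /\
       (fun n => (erg_avg Tinv f n x)%:E) @ \oo --> c /\
       (fun n => (bil_avg T Tinv f n x)%:E) @ \oo --> c}.
Proof.
move=> [E [mE [E0 limE]]].
have eT : ergodic_map mu T by split.
have eTi := ergodic_map_inv eT hTK mTinv.
pose Ek (k : nat) := \bigcap_n [set x | bil_avg T Tinv f n x <= k%:R].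
have mEk k : measurable (Ek k).
  apply: bigcapT_measurable => n.
  have : measurable_fun setT (bil_avg T Tinv f n).
    rewrite (_ : bil_avg T Tinv f n = fun x => ((n.*2).+1%:R)^-1 *
      (birkhoff_sum T f n.+1 x + birkhoff_sum Tinv f n.+1 x - f x)); last first.
      by apply/funext => x; exact: bil_avgE.
    apply: measurable_funM => //; apply: measurable_funB => //.
    apply: measurable_funD; first exact: (measurable_birkhoff_sum eT).
    exact: (measurable_birkhoff_sum eTi).
  move=> /(_ measurableT _ (measurable_itv `]-oo, k%:R])).
  by rewrite setTI; congr measurable; apply/seteqP; split => x /=; rewrite in_itv.
(* Up to a null set, [E] is covered by the countably many [Ek k], so they cannot all be null. *)
have [k Ek0] : exists k, (0 < mu (Ek k))%E.
  apply: contrapT => /forallNP Ek0.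
  suff /(measure_negligible mE) E00 : mu.-negligible E by rewrite E00 ltxx in E0.
  case: limE => A [mA A0 subA].
  apply: (@negligibleS _ _ _ _ (A `|` \bigcup_k Ek k)).
    move=> x Ex; have [Ax|nAx] := pselect (A x); [by left|right].
    have /limn_esup_lty_bounded[k bk] :
        (limn_esup (fun n => (bil_avg T Tinv f n x)%:E) < +oo)%E.
      by apply: contrapT => nlim; apply: nAx; apply: subA => /(_ Ex).
    by exists k => // n _ /=; exact: bk.
  apply: negligibleU; first by exists A; split.
  apply: negligible_bigcup => k; exists (Ek k); split => //.
  by apply/eqP; rewrite eq_le measure_ge0 leNgt andbT; apply/negP/Ek0.
(* Subtracting [k] makes the bilateral averages nonpositive on [Ek k], a condition symmetric in [T]
   and [Tinv]; the rate is shifted back by [k] at the end. *)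
pose g y := f y - k%:R.
have mg : measurable_fun setT g by exact: measurable_funB.
have gk y : Ek k y -> forall n, bil_avg T Tinv g n y <= 0.
  by move=> Eky n; rewrite bil_avgB subr_le0; exact: Eky.
have gk' y : Ek k y -> forall n, bil_avg Tinv T g n y <= 0.
  by move=> Eky n; rewrite bil_avgC; exact: gk.
have bT : {ae mu, forall x, bounded_sums T g x}.
  have := birkhoff_sum_bounded_of_bil_avg eT hTK (mEk k) Ek0 gk.
  by apply: filterS => x /bounded_sumsP.
have bTi : {ae mu, forall x, bounded_sums Tinv g x}.
  have := birkhoff_sum_bounded_of_bil_avg eTi hKT (mEk k) Ek0 gk'.
  by apply: filterS => x /bounded_sumsP.
have [c cy rate] := two_sided_birkhoff_rate eT hTK hKT mTinv mg bT bTi.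
have cky : (c + k%:R%:E)%E != +oo%E by case: c cy {rate}.
exists (c + k%:R%:E)%E; split => //.
have fE : f = (fun y => g y + k%:R) by apply/funext => y; rewrite /g subrK.
move: rate; apply: filterS => x [rT rTi].
move: (birkhoff_rateD k%:R rT) (birkhoff_rateD k%:R rTi).
rewrite -fE => {}rT {}rTi.
by split; [exact: cvg_erg_avg|split; [exact: cvg_erg_avg|exact: cvg_bil_avg]].
Qed.
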